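(* Under the hypotheses and notation of the statement that $\psi$ is a faithful embedding (irreducible principally polarized tropical abelian surface $(X,Q)$, representatives $b_0,\dots,b_3$ of $M/2\lambda(M')$, $\psi:Y=X/\langle-1\rangle\to\mathbb{TP}^3$, $[x]\mapsto(\vartheta_{b_0}(x):\dots:\vartheta_{b_3}(x))$), set $\tau_0=(\vartheta_{b_0}(0):\vartheta_{b_1}(0):\vartheta_{b_2}(0):\vartheta_{b_3}(0))$. Let the Klein group $V_4=\{\mathrm{id},(0\,1)(2\,3),(0\,2)(1\,3),(0\,3)(1\,2)\}$ act on $\mathbb{TP}^3$ by permuting coordinates and let $\iota(x_0:\dots:x_3)=(-x_0:\dots:-x_3)$. Then $\psi(Y)$, viewed in the principal torus $\cong\mathbb{R}^3$, is the boundary surface of a parallelepiped whose eight vertices are the points $g\cdot\tau_0$, $g\in V_4\times\langle\iota\rangle$, namely $\tau_i=(0\,i)(j\,k)\cdot\tau_0$ and $\widetilde\tau_i=\iota(\tau_i)$ for $i=0,1,2,3$ (with $\{i,j,k\}=\{1,2,3\}$ for $i\neq 0$).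
   Context: $M$ free of rank 2, $N=\mathrm{Hom}(M,\mathbb{Z})\subseteq N_\mathbb{R}=\mathrm{Hom}(M,\mathbb{R})$, $M'\subseteq N_\mathbb{R}$ a full lattice, $X=N_\mathbb{R}/M'$. A principal polarization is a positive-definite symmetric bilinear form $Q$ on $N_\mathbb{R}$ with $Q(M'\times N)\subseteq\mathbb{Z}$ such that $\lambda:M'\to M$, $\lambda(u')=Q(u',\cdot)|_N$, is an isomorphism. $(X,Q)$ is irreducible if it is not isomorphic (via a $\mathbb{Z}$-isomorphism of integral structures carrying lattice to lattice and form to form) to a product $(E_1\times E_2,Q_1\oplus Q_2)$ of polarized one-dimensional tropical abelian varieties. $\vartheta_b(x)=\min_{u'\in M'}\big(2Q(x,u'+(2\lambda)_\mathbb{R}^{-1}(b))+Q(u'+(2\lambda)_\mathbb{R}^{-1}(b),u'+(2\lambda)_\mathbb{R}^{-1}(b))\big)$. The principal torus of $\mathbb{TP}^3$ is $\mathbb{R}^4/\mathbb{R}(1,1,1,1)\cong\mathbb{R}^3$. *)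

(* Defs.v *)
From HB Require Import structures.
From mathcomp Require Import all_boot all_order all_algebra all_fingroup.
From mathcomp Require Import all_classical reals.
Set Implicit Arguments. Unset Strict Implicit. Unset Printing Implicit Defensive.
Import Order.TTheory GRing.Theory Num.Theory.
Local Open Scope ring_scope.
Local Open Scope classical_set_scope.

(* Conventions.  M = Z^2 (a fixed basis), N = Hom(M,Z) = Z^2 (dual basis),
   N_R = R^2 as row vectors 'rV[R]_2, M_R = R^2 as row vectors.
   The full lattice M' in N_R is the Z-span of the rows of an invertible
   matrix L.  A symmetric bilinear form on N_R is a matrix Q. *)

Section TropAb.
Variable R : realType.

Definition ivec n (k : 'rV[int]_n) : 'rV[R]_n := map_mx (fun z : int => z%:~R) k.

Definition form (Q : 'M[R]_2) (x y : 'rV[R]_2) : R := (x *m Q *m y^T) 0 0.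

Definition in_lattice (L : 'M[R]_2) (u : 'rV[R]_2) : Prop :=
  exists k : 'rV[int]_2, u = ivec k *m L.

(* lambda(u') = Q(u',.)|_N, in coordinates w.r.t. the dual basis of M *)
Definition lam (Q : 'M[R]_2) (u : 'rV[R]_2) : 'rV[R]_2 := u *m Q.

Definition principal_polarization (L Q : 'M[R]_2) : Prop :=
  [/\ Q^T = Q,
      (forall x : 'rV[R]_2, x != 0 -> 0 < form Q x x),
      (forall u n, in_lattice L u -> form Q u (ivec n) \is a Num.int),
      (forall u v, in_lattice L u -> in_lattice L v -> lam Q u = lam Q v -> u = v) &
      (forall m : 'rV[int]_2, exists2 u, in_lattice L u & lam Q u = ivec m)].

(* (X,Q) is isomorphic to a product (E1 x E2, Q1 (+) Q2) of polarized
   one-dimensional tropical abelian varieties: a Z-isomorphism A of N = Z^2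
   onto N1 (+) N2 = Z^2 (acting on N_R by x |-> x A) carrying M' onto
   M'_1 x M'_2 = a1 Z x a2 Z and Q to Q1 (+) Q2, Qi(s,t) = qi s t, qi > 0. *)
Definition is_product (L Q : 'M[R]_2) : Prop :=
  exists (A : 'M[int]_2) (a1 a2 q1 q2 : R),
    [/\ A \in unitmx, [/\ a1 != 0, a2 != 0, 0 < q1 & 0 < q2],
     (forall y : 'rV[R]_2,
        (exists2 x, in_lattice L x & y = x *m map_mx (fun z : int => z%:~R) A)
        <-> (exists k1 k2 : int, y = \row_(i < 2) (if i == 0 then a1 * k1%:~R
                                                               else a2 * k2%:~R))) &
     (forall x y : 'rV[R]_2,
        let x' := x *m map_mx (fun z : int => z%:~R) A in
        let y' := y *m map_mx (fun z : int => z%:~R) A in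
        form Q x y = q1 * (x' 0 0 * y' 0 0) + q2 * (x' 0 1 * y' 0 1))].

Definition irreducible (L Q : 'M[R]_2) : Prop := ~ is_product L Q.

Definition reps (L Q : 'M[R]_2) (b : 'I_4 -> 'rV[int]_2) : Prop :=
  forall m : 'rV[int]_2, exists! i : 'I_4,
    exists2 u, in_lattice L u & ivec m - ivec (b i) = 2%:R *: lam Q u.

Definition half_char (Q : 'M[R]_2) (b : 'rV[int]_2) : 'rV[R]_2 :=
  2%:R^-1 *: (ivec b *m invmx Q).

(* theta_b(x) = min_{u' in M'} (2Q(x,u'+c) + Q(u'+c,u'+c)), c = (2 lambda)_R^{-1} b;
   the minimum is attained, so it is the infimum *)
Definition theta (L Q : 'M[R]_2) (b : 'rV[int]_2) (x : 'rV[R]_2) : R :=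
  inf [set t : R | exists2 u, in_lattice L u &
         t = 2%:R * form Q x (u + half_char Q b)
             + form Q (u + half_char Q b) (u + half_char Q b)].

Definition psi_hom (L Q : 'M[R]_2) (b : 'I_4 -> 'rV[int]_2) (x : 'rV[R]_2)
  : 'I_4 -> R := fun i => theta L Q (b i) x.

(* principal torus R^4 / R(1,1,1,1) identified with R^3 via
   (y0,y1,y2,y3) |-> (y1 - y0, y2 - y0, y3 - y0) *)
Definition torus_coord (y : 'I_4 -> R) : 'rV[R]_3 :=
  \row_(j < 3) (y (lift ord0 j) - y ord0).

Definition perm_act (s : {perm 'I_4}) (y : 'I_4 -> R) : 'I_4 -> R :=
  fun i => y ((s^-1)%g i).

Definition iota_act (y : 'I_4 -> R) : 'I_4 -> R := fun i => - y i.

Definition o0 : 'I_4 := ord0.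
Definition o1 : 'I_4 := inord 1.
Definition o2 : 'I_4 := inord 2.
Definition o3 : 'I_4 := inord 3.

Definition klein : {set {perm 'I_4}} :=
  [set 1%g; (tperm o0 o1 * tperm o2 o3)%g; (tperm o0 o2 * tperm o1 o3)%g;
        (tperm o0 o3 * tperm o1 o2)%g].

Definition klein_iota_orbit (t : 'I_4 -> R) : set 'rV[R]_3 :=
  [set z | exists s, exists e : bool, s \in klein /\
       z = torus_coord ((if e then iota_act else id) (perm_act s t))].

(* Nondegenerate parallelepiped with base vertex p and edge vectors the rows
   of V (V invertible): vertex set and boundary surface (union of 6 faces). *)
Definition ppd_vertices (p : 'rV[R]_3) (V : 'M[R]_3) : set 'rV[R]_3 :=
  [set z | exists e : 'I_3 -> bool,
      z = p + (\row_(i < 3) (if e i then 1 else 0)) *m V].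

Definition ppd_boundary (p : 'rV[R]_3) (V : 'M[R]_3) : set 'rV[R]_3 :=
  [set z | exists t : 'rV[R]_3,
      [/\ (forall i, 0 <= t 0 i <= 1), (exists i, t 0 i = 0 \/ t 0 i = 1) &
          z = p + t *m V]].

End TropAb.

(* Main.v *)
Require Import Defs.
From HB Require Import structures.
From mathcomp Require Import all_boot all_order all_algebra all_fingroup.
From mathcomp Require Import all_classical reals.
From mathcomp Require Import ring lra zify.
Import Order.TTheory GRing.Theory Num.Theory.
Local Open Scope ring_scope.
Local Open Scope classical_set_scope.


(* Put G = Q^-1.  Then M' = Z^2 G and theta_b(x) is the minimum of
   x.v + vGv^T/4 over v = b mod 2.  Irreducibility gives a strictly obtuse
   superbase of Z^2, hence coordinates n in Z^3 with n_0 + n_1 + n_2 = 0 in which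
   theta_b(x) = min sum_j (p_j n_j^2 - y_j n_j) over the n of the parity of b, with
   all p_j > 0 and y only defined modulo (1,1,1).  This freedom allows to choose y
   on a "wall": y_j in [2 p_j k_j, 2 p_j (k_j + 1)] with k_0 + k_1 + k_2 = -1, and
   y_i = 2 p_i k_i for some i.  There the three one-dimensional minimizations
   decouple, so theta_b(x) = A + sum_j (-1)^(b_j) D_j / 2, where D_j is a zigzag
   function of y_j with values in [-p_j, p_j], and D_i = p_i or -p_i on the wall.
   As (D_0,D_1,D_2) runs over the boundary of the box this yields the boundary of a
   parallelepiped; y = 0 gives the vertex D = -p, on which V_4 changes an even
   number of signs and iota all of them. *)

(** * Reduction of positive definite binary quadratic forms *)

Section BinaryForms.
Variables (R : realType) (g h l : R).
Hypotheses (g_gt0 : 0 < g) (det_gt0 : 0 < g * l - h ^+ 2).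

Definition bform (a b c d : int) : R :=
  g * a%:~R * c%:~R + h * (a%:~R * d%:~R + b%:~R * c%:~R) + l * b%:~R * d%:~R.

Lemma l_gt0 : 0 < l.
Proof.
rewrite -(pmulr_rgt0 _ g_gt0); apply: le_lt_trans (sqr_ge0 h) _.
by rewrite -subr_gt0.
Qed.

Lemma bform_ge0 a b : 0 <= bform a b a b.
Proof.
rewrite -(pmulr_rge0 _ g_gt0) /bform.
set x : R := a%:~R; set y : R := b%:~R.
have -> : g * (g * x * x + h * (x * y + y * x) + l * y * y) =
  (g * x + h * y) ^+ 2 + (g * l - h ^+ 2) * y ^+ 2 by ring.
by rewrite addr_ge0 ?sqr_ge0 // mulr_ge0 ?sqr_ge0 // ltW.
Qed.

(** Completing the square bounds (g l - h^2) a^2 by l q(a, b) and (g l - h^2) b^2 by g q(a, b),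
    where q is the quadratic form of [bform]. The factor [g + l] in [B] serves both bounds. *)
Lemma bform_bound (C : R) : exists K : nat, forall a b : int,
  bform a b a b <= C -> (`|a| <= K /\ `|b| <= K)%N.
Proof.
have l0 := l_gt0.
pose B := Num.max 0 C * (g + l) / (g * l - h ^+ 2).
have B0 : 0 <= B.
  rewrite /B !mulr_ge0 ?invr_ge0 ?(ltW det_gt0) ?addr_ge0 ?(ltW g_gt0) ?(ltW l0) //.
  by rewrite le_max lexx.
exists (Num.truncn B).+1 => a b Hab.
have key (z : int) : z%:~R ^+ 2 <= B -> (`|z| <= (Num.truncn B).+1)%N.
  move=> Hz.
  have /andP[_ HB] := truncn_itv B0.
  have : (z ^+ 2 < (Num.truncn B).+1%:Z)%R.
    rewrite -(ltr_int R) rmorphXn /=; exact: le_lt_trans Hz HB.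
  by nia.
have Hq : bform a b a b <= Num.max 0 C by rewrite le_max Hab orbT.
have m0 : 0 <= Num.max 0 C by rewrite le_max lexx.
split; apply: key; rewrite /B ler_pdivlMr //.
- apply: (@le_trans _ _ (l * bform a b a b)).
    rewrite -subr_ge0 /bform; set x : R := a%:~R; set y : R := b%:~R.
    have -> : l * (g * x * x + h * (x * y + y * x) + l * y * y)
      - x ^+ 2 * (g * l - h ^+ 2) = (h * x + l * y) ^+ 2 by ring.
    exact: sqr_ge0.
  apply: (@le_trans _ _ (l * Num.max 0 C)); first by rewrite ler_pM2l.
  by rewrite mulrC ler_wpM2l // lerDr ltW.
- apply: (@le_trans _ _ (g * bform a b a b)).
    rewrite -subr_ge0 /bform; set x : R := a%:~R; set y : R := b%:~R.
    have -> : g * (g * x * x + h * (x * y + y * x) + l * y * y)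
      - y ^+ 2 * (g * l - h ^+ 2) = (g * x + h * y) ^+ 2 by ring.
    exact: sqr_ge0.
  apply: (@le_trans _ _ (g * Num.max 0 C)); first by rewrite ler_pM2l.
  by rewrite mulrC ler_wpM2l // lerDl ltW.
Qed.

Lemma minimal_basis : exists a b c d : int, a * d - b * c = 1 /\
  forall a' b' c' d' : int, a' * d' - b' * c' = 1 ->
    bform a b a b + bform c d c d <= bform a' b' a' b' + bform c' d' c' d'.
Proof.
pose tr a b c d := bform a b a b + bform c d c d.
have [K HK] := bform_bound (tr 1 0 0 1).
pose T := ('I_(2 * K.+1).+1 * 'I_(2 * K.+1).+1 * ('I_(2 * K.+1).+1 * 'I_(2 * K.+1).+1))%type.
(* The box is [-(K+1), K+1] rather than [-K, K], so that it contains the standard basis even when K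
   = 0. *)
pose dec (i : 'I_(2 * K.+1).+1) : int := i%:Z - K.+1%:Z.
pose P (t : T) := dec t.1.1 * dec t.2.2 - dec t.1.2 * dec t.2.1 == 1.
pose f (t : T) := tr (dec t.1.1) (dec t.1.2) (dec t.2.1) (dec t.2.2).
have decP (z : int) : (`|z| <= K.+1)%N -> exists i, dec i = z.
  move=> Hz; have Hi : (`|(z + K.+1%:Z)%R| < (2 * K.+1).+1)%N by lia.
  by exists (Ordinal Hi); rewrite /dec /=; lia.
have [i1 Hi1] := decP 1 isT; have [i0 Hi0] := decP 0 isT.
pose t0 : T := ((i1, i0), (i0, i1)).
have Pt0 : P t0 by rewrite /P /= Hi1 Hi0.
(* Every basis with a smaller value of [tr] lies in the box, so it suffices to
   minimize over the box. *)
case: (arg_minP f Pt0) => t Pt Ht.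
exists (dec t.1.1), (dec t.1.2), (dec t.2.1), (dec t.2.2); split; first exact/eqP.
move=> a b c d Hdet.
have Hle : f t <= tr 1 0 0 1 by rewrite -Hi1 -Hi0; apply: (Ht t0).
have [Hbig|Hsmall] := ltP (tr 1 0 0 1) (tr a b c d).
  exact: le_trans Hle (ltW Hbig).
have Ha : bform a b a b <= tr 1 0 0 1.
  by apply: le_trans Hsmall; rewrite lerDl bform_ge0.
have Hc : bform c d c d <= tr 1 0 0 1.
  by apply: le_trans Hsmall; rewrite lerDr bform_ge0.
have [/leqW/decP[ia Hia] /leqW/decP[ib Hib]] := HK _ _ Ha.
have [/leqW/decP[ic Hic] /leqW/decP[id Hid]] := HK _ _ Hc.
have := Ht ((ia, ib), (ic, id)).
by rewrite /P /f /= Hia Hib Hic Hid; apply; apply/eqP.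
Qed.

(** In a basis (u, v) of minimal trace, replacing one vector by its sum or difference with the other
    cannot lower the trace; hence q(u) and q(v) are at least 2 |B(u, v)|. The conclusion says that
    u, v, -u-v have pairwise nonpositive products. *)
Lemma obtuse_basis : exists a b c d : int,
  [/\ a * d - b * c = 1, bform a b c d <= 0,
      0 <= bform a b a b + bform a b c d & 0 <= bform c d c d + bform a b c d].
Proof.
have [a [b [c [d [Hdet Hmin]]]]] := minimal_basis.
have H1 := Hmin a b (c + a) (d + b) ltac:(lia).
have H2 := Hmin a b (c - a) (d - b) ltac:(lia).
have H3 := Hmin (a + c) (b + d) c d ltac:(lia).
have H4 := Hmin (a - c) (b - d) c d ltac:(lia).
have [Hle|Hlt] := leP (bform a b c d) 0.
  exists a, b, c, d; move: H1 H2 H3 H4; rewrite /bform !rmorphD !rmorphN /= => H1 H2 H3 H4.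
  by split=> //; move: Hle; rewrite /bform; lra.
(* Passing from (u, v) to (v, -u) keeps the determinant and flips the sign of the product. *)
exists c, d, (- a), (- b); move: H1 H2 H3 H4 Hlt.
rewrite /bform !rmorphD !rmorphN /= => H1 H2 H3 H4 Hlt.
split; [lia | lra | lra | lra].
Qed.
End BinaryForms.

(** * Sum-zero integer triples of given parity and the decoupled minimization *)

Definition even3 (w : 'I_3 -> bool) : bool :=
  w ord0 (+) (w (lift ord0 ord0) (+) w (lift ord0 (lift ord0 ord0))) == false.

Lemma even3E w : even3 w ->
  w (lift ord0 (lift ord0 ord0)) = w ord0 (+) w (lift ord0 ord0).
Proof. by rewrite /even3; do 3 (case: (w _)). Qed.

Section SplitTheta.
Context {R : realType}.
Implicit Types (p y : 'I_3 -> R) (k n : 'I_3 -> int) (e : 'I_3 -> bool).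

Definition zodd (n : int) : bool := odd `|n|%N.

Definition parabola (p y : R) (n : int) : R := p * n%:~R ^+ 2 - y * n%:~R.

(** With n = k + 2j the difference of values is 2j (2pj - (y - 2pk)), and the bound on y - 2pk
    prevents the second factor from having the sign opposite to j. *)
Lemma parabola_min (p y : R) (k n : int) :
  0 < p -> zodd n = zodd k -> `|y - 2 * p * k%:~R| <= 2 * p ->
  parabola p y k <= parabola p y n.
Proof.
move=> p0 Hnk /ler_normlP[Hl Hr].
have [j ->] : exists j : int, n = k + 2 * j.
  by exists ((n - k) %/ 2)%Z; move: Hnk; rewrite /zodd; lia.
rewrite -subr_ge0.
have -> : parabola p y (k + 2 * j) - parabola p y k =
    2 * (j%:~R * (2 * p * j%:~R - (y - 2 * p * k%:~R))).
  by rewrite /parabola !rmorphD !rmorphM /=; ring.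
rewrite mulr_ge0 //.
have [j1|j0|->] := ltgtP j 0; last by rewrite mul0r.
- have : j%:~R <= (-1)%:~R :> R by rewrite ler_int; lia.
  rewrite rmorphN /= => Hj; apply: mulr_le0; first lra.
  have : p * (j%:~R + 1) <= 0 by rewrite pmulr_rle0 //; lra.
  by move=> Hpj; lra.
- have : 1 <= (j%:~R : R) by rewrite -[1]/(1%:~R) ler_int.
  move=> Hj; apply: mulr_ge0; first lra.
  have : 0 <= p * (j%:~R - 1) by rewrite pmulr_rge0 //; lra.
  by move=> Hpj; lra.
Qed.

(* The infimum of this set is theta_b: [y] modulo (1,1,1) encodes its argument, and
   the sum-zero triples [n] of parity [e] are the vectors v = b mod 2. *)
Definition theta_values p y e : set R :=
  [set t | exists2 n : 'I_3 -> int, \sum_j n j = 0 /\ (forall j, zodd (n j) = e j)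
     & t = \sum_j parabola (p j) (y j) (n j)].

Lemma theta_values_shift p y e (d : R) :
  theta_values p (fun j => y j + d) e = theta_values p y e.
Proof.
apply/seteqP; split=> t [n [Hn He] ->]; exists n => //;
  apply/eqP; rewrite -subr_eq0 -sumrB; apply/eqP.
- rewrite (eq_bigr (fun j => - d * (n j)%:~R)); last by move=> j _; rewrite /parabola; ring.
  by rewrite -mulr_sumr -rmorph_sum /= Hn mulr0.
- rewrite (eq_bigr (fun j => d * (n j)%:~R)); last by move=> j _; rewrite /parabola; ring.
  by rewrite -mulr_sumr -rmorph_sum /= Hn mulr0.
Qed.

(** For p_j > 0 this says that y_j / (2 p_j), the real minimizer of the j-th parabola, lies in
    [k_j, k_j + 1]. *)
Definition in_cell p y k :=
  (forall j, 2 * p j * (k j)%:~R <= y j <= 2 * p j * (k j + 1)%:~R).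

Definition on_wall p y k :=
  \sum_j k j = -1 /\ exists i, y i = 2 * p i * (k i)%:~R.

Lemma inf_min (S : set R) (t : R) : S t -> (forall u, S u -> t <= u) -> inf S = t.
Proof.
move=> St tlb; apply/eqP; rewrite eq_le; apply/andP; split.
  by apply: ge_inf => //; exists t.
by apply: lb_le_inf => //; exists t.
Qed.

Lemma sum3 (V : nmodType) (f : 'I_3 -> V) :
  \sum_j f j = f ord0 + f (lift ord0 ord0) + f (lift ord0 (lift ord0 ord0)).
Proof. by rewrite !big_ord_recl big_ord0 addr0 addrA. Qed.

(** The end of [k, k + 1] of parity [e]; on the cell of k it minimizes the parabola within its
    parity class. *)
Definition nearest (k : int) (e : bool) : int := k + (zodd k (+) e)%:Z.

Lemma zodd_nearest (z : int) (c : bool) : zodd (nearest z c) = c.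
Proof. by rewrite /nearest /zodd; case: c => /=; case: (boolP (odd _)) => /=; lia. Qed.

(** The separate minimizers bound every admissible value from below. Their sum is -1 plus the number
    of upper ends chosen, and it is even because [e] is, so it is 0 or 2; only the value 2 requires
    a correction. *)
Lemma inf_theta_values p y k e :
  (forall j, 0 < p j) -> in_cell p y k -> on_wall p y k ->
  even3 e ->
  inf (theta_values p y e) = \sum_j parabola (p j) (y j) (nearest (k j) (e j)).
Proof.
move=> p0 Hc [Hs [i Hi]] /eqP He; apply: inf_min; last first.
  move=> t [n [_ Hn] ->]; apply: ler_sum => j _.
  apply: parabola_min => //; first by rewrite zodd_nearest Hn.
  have /andP[H1 H2] := Hc j; have := p0 j.
  rewrite /nearest; case: addb; rewrite ler_norml; move: H1 H2;
    rewrite ?addr0 ?rmorphD /= => H1 H2 Hp; apply/andP; split; lra.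
have Hex j : zodd (nearest (k j) (e j)) = e j by exact: zodd_nearest.
have [Hz|Hz] : \sum_j nearest (k j) (e j) = 0 \/ \sum_j nearest (k j) (e j) = 2.
  move: Hs He (Hex ord0) (Hex (lift ord0 ord0)) (Hex (lift ord0 (lift ord0 ord0))).
  rewrite !sum3 /nearest.
  by do 3 (case: (e _)); do 3 (case: (zodd (k _))) => //=; rewrite /zodd; lia.
- by exists (fun j => nearest (k j) (e j)).
(* All three nearest points are the upper ends of their cells; on the wall the
   upper end may be traded for the point two below it. *)
have Hup j : nearest (k j) (e j) = k j + 1.
  have Hge (i' : 'I_3) : true -> 0 <= k i' + 1 - nearest (k i') (e i').
    by move=> _; rewrite /nearest; case: addb => /=; lia.
  have H0 : \sum_j (k j + 1 - nearest (k j) (e j)) = 0.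
    by rewrite sumrB big_split /= Hs Hz sumr_const card_ord.
  by apply/esym/eqP; rewrite -subr_eq0; apply/eqP; exact: (psumr_eq0P Hge H0).
exists (fun j => nearest (k j) (e j) - 2 * (j == i)%:Z).
  split=> [|j]; last by rewrite -[RHS](Hex j) /zodd; case: (j == i); lia.
  rewrite big_split /= Hz (bigD1 i) //= eqxx big1 ?addr0; first by lia.
  by move=> j /negPf ->; rewrite mulr0 oppr0.
apply: eq_bigr => j _; case: eqP => [->|_]; last by rewrite mulr0 subr0.
by rewrite Hup /parabola Hi !rmorphD !rmorphN /=; ring.
Qed.
End SplitTheta.

(** * Translation along (1,1,1) onto a wall *)

Section WallShift.
Context {R : realType}.
Variable p : 'I_3 -> R.
Hypothesis p_gt0 : forall j, 0 < p j.
Implicit Types (y : 'I_3 -> R) (k : 'I_3 -> int).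

(** All y_j are raised together until the first one reaches the top of its cell; that one then also
    lies in the next cell. *)
Lemma next_upper_wall y k : in_cell p y k ->
  exists d i, in_cell p (fun j => y j + d) (fun j => k j + (j == i)%:Z).
Proof.
move=> Hc; pose gap j := 2 * p j * (k j + 1)%:~R - y j.
have [i _ Hi] := @arg_minP _ _ _ ord0 xpredT gap isT.
exists (gap i), i => j; have /andP[H1 H2] := Hc j; have := Hi j isT.
have /andP[H3 H4] := Hc i; have pj := p_gt0 j; rewrite /gap.
case: eqP => [->|_] /=; rewrite ?addr0 => Hij.
  by rewrite ![(_ + 1)%:~R]rmorphD /=; apply/andP; split; have := p_gt0 i; lra.
by apply/andP; split; lra.
Qed.

Lemma next_lower_wall y k : in_cell p y k ->
  exists d i, [/\ in_cell p (fun j => y j + d) k,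
    in_cell p (fun j => y j + d) (fun j => k j - (j == i)%:Z) &
    y i + d = 2 * p i * (k i)%:~R].
Proof.
move=> Hc; pose gap j := y j - 2 * p j * (k j)%:~R.
have [i _ Hi] := @arg_minP _ _ _ ord0 xpredT gap isT.
have Hc' : in_cell p (fun j => y j - gap i) k.
  move=> j; have /andP[H1 H2] := Hc j; have := Hi j isT.
  have /andP[H3 H4] := Hc i; rewrite /gap => Hij.
  by apply/andP; split; lra.
exists (- gap i), i; split=> //; last by rewrite /gap; ring.
move=> j; have := Hc' j; case: eqP => [->|_] /=; last by rewrite subr0.
rewrite subrK !rmorphD /= /gap => /andP[H1 H2]; have := p_gt0 i => pi0.
by apply/andP; split; lra.
Qed.

(** Crossing a wall changes the sum of the k_j by one, so the induction is on the distance of this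
    sum from -1. Once it equals -1, a last descent to the nearest lower wall leaves k unchanged. *)
Lemma wall_shift y :
  exists d k, in_cell p (fun j => y j + d) k /\ on_wall p (fun j => y j + d) k.
Proof.
have [k Hc] : exists k, in_cell p y k.
  exists (fun j => Num.floor (y j / (2 * p j))) => j.
  have /andP[H1 H2] := floor_itv (y j / (2 * p j)).
  have pj : 0 < 2 * p j by rewrite mulr_gt0.
  apply/andP; split; first by rewrite mulrC -ler_pdivlMr.
  by rewrite mulrC -ler_pdivrMr // ltW.
have [N HN] : exists N, N = `|(\sum_j k j + 1)%R|%N by eexists.
elim: N y k Hc HN => [|N IH] y k Hc HN.
  have [d [i [H1 _ H2]]] := next_lower_wall _ _ Hc.
  by exists d, k; split=> //; split; [lia | exists i].
suff [d [k' [Hc' HN']]] : exists d k', in_cell p (fun j => y j + d) k' /\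
    N = `|(\sum_j k' j + 1)%R|%N.
  have [d' [k'' [H1 [H2 [i H3]]]]] := IH _ _ Hc' HN'.
  exists (d + d'), k''; split; first by move=> j; rewrite addrA.
  by split=> //; exists i; rewrite addrA.
have sum_delta i : \sum_(j < 3) (j == i)%:Z = 1.
  by rewrite (bigD1 i) //= eqxx big1 ?addr0 // => j /negPf ->.
have [Hneg|Hpos] := ltP (\sum_j k j + 1) 0.
- have [d [i H]] := next_upper_wall _ _ Hc.
  exists d, (fun j => k j + (j == i)%:Z); split=> //.
  rewrite big_split /= sum_delta; move: Hneg HN.
  by move: (\sum_j k j) => S; lia.
- have [d [i [_ H _]]] := next_lower_wall _ _ Hc.
  exists d, (fun j => k j - (j == i)%:Z); split=> //.
  rewrite sumrB sum_delta; move: Hpos HN.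
  by move: (\sum_j k j) => S; lia.
Qed.
End WallShift.

(** * The zigzag function as a difference of parity minima *)

Section Zigzag.
Context {R : realType}.

Definition bsgn (c : bool) : R := (-1) ^+ c.

(** The value of the parabola at the even end of [k, k + 1] minus its value at the odd end. *)
Definition zigzag (p y : R) (k : int) : R := bsgn (zodd k) * (y - p * (2 * k + 1)%:~R).

Lemma parabola_nearest (p y : R) (k : int) (c : bool) :
  parabola p y (nearest k c) =
  (parabola p y k + parabola p y (k + 1)) / 2 + bsgn c * zigzag p y k / 2.
Proof.
rewrite /nearest /zigzag /bsgn; case: (zodd k); case: c;
  rewrite /= ?addr0 /parabola !rmorphD rmorphM /= ?expr0 ?expr1; by field.
Qed.

Lemma zigzag_bound (p y : R) (k : int) :
  2 * p * k%:~R <= y <= 2 * p * (k + 1)%:~R -> - p <= zigzag p y k <= p.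
Proof.
rewrite /zigzag /bsgn !rmorphD rmorphM /= => /andP[H1 H2].
by apply/andP; case: (zodd k); rewrite ?expr0 ?expr1; split; lra.
Qed.

Lemma zigzag_wall (p : R) (k : int) :
  zigzag p (2 * p * k%:~R) k = - p \/ zigzag p (2 * p * k%:~R) k = p.
Proof.
rewrite /zigzag /bsgn !rmorphD rmorphM /=.
by case: (zodd k); rewrite ?expr0 ?expr1; [right|left]; ring.
Qed.

Lemma zigzag_surj (p D : R) (k : int) : - p <= D <= p ->
  exists y, 2 * p * k%:~R <= y <= 2 * p * (k + 1)%:~R /\ zigzag p y k = D.
Proof.
move=> /andP[H1 H2]; exists (bsgn (zodd k) * D + p * (2 * k + 1)%:~R); split.
  rewrite /bsgn !rmorphD rmorphM /=.
  by apply/andP; case: (zodd k); rewrite ?expr0 ?expr1; split; lra.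
by rewrite /zigzag addrK mulrA /bsgn -expr2 sqrr_sign mul1r.
Qed.
End Zigzag.

(** * Small index types and the transitivity of the Klein group *)

Lemma ord3_ind (P : 'I_3 -> Prop) : P ord0 -> P (lift ord0 ord0) ->
  P (lift ord0 (lift ord0 ord0)) -> forall j, P j.
Proof.
move=> H0 H1 H2 [[|[|[|//]]] h].
- by rewrite (_ : Ordinal h = ord0) //; apply: val_inj.
- by rewrite (_ : Ordinal h = lift ord0 ord0) //; apply: val_inj.
- by rewrite (_ : Ordinal h = lift ord0 (lift ord0 ord0)) //; apply: val_inj.
Qed.

Lemma ord4_ind (P : 'I_4 -> Prop) : P o0 -> P o1 -> P o2 -> P o3 -> forall i, P i.
Proof.
move=> H0 H1 H2 H3 [[|[|[|[|//]]]] h].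
- by rewrite (_ : Ordinal h = o0) //; apply: val_inj.
- by rewrite (_ : Ordinal h = o1) //; apply: val_inj; rewrite /= inordK.
- by rewrite (_ : Ordinal h = o2) //; apply: val_inj; rewrite /= inordK.
- by rewrite (_ : Ordinal h = o3) //; apply: val_inj; rewrite /= inordK.
Qed.

Lemma o_neq : ((o0 == o1 = false) * (o0 == o2 = false) * (o0 == o3 = false) *
  (o1 == o0 = false) * (o1 == o2 = false) * (o1 == o3 = false) *
  (o2 == o0 = false) * (o2 == o1 = false) * (o2 == o3 = false) *
  (o3 == o0 = false) * (o3 == o1 = false) * (o3 == o2 = false))%type.
Proof. by do !split; rewrite -val_eqE /= ?inordK. Qed.

Lemma klein_transitive i : exists2 s, s \in klein & (s^-1)%g o0 = i.
Proof.
move: i; apply: ord4_ind;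
  [exists 1%g | exists (tperm o0 o1 * tperm o2 o3)%g |
   exists (tperm o0 o2 * tperm o1 o3)%g | exists (tperm o0 o3 * tperm o1 o2)%g];
  rewrite ?inE ?eqxx ?orbT // ?invg1 ?invMg ?tpermV ?permM ?permE /= ?(eqxx, o_neq) /= ?permE /=
    ?(eqxx, o_neq) //=.
Qed.

(** * Theta characteristics as the points of F_2^2 *)

Section Characteristics.
Variable c : 'I_4 -> 'I_3 -> bool.
Hypothesis c_even : forall i, even3 (c i).
Hypothesis c_inj : forall i i', (forall j, c i j = c i' j) -> i = i'.

Let f i : bool * bool := (c i ord0, c i (lift ord0 ord0)).

Definition coord3 (u : bool * bool) (j : 'I_3) : bool :=
  nth false [:: u.1; u.2; u.1 (+) u.2] j.

Lemma c_coord3 i j : c i j = coord3 (f i) j.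
Proof.
have /eqP := c_even i; move: j; apply: ord3_ind; rewrite /coord3 //=.
by do 3 (case: (c i _)).
Qed.

Lemma f_inj : injective f.
Proof. by move=> i i' Hf; apply: c_inj => j; rewrite !c_coord3 Hf. Qed.

Lemma f_bij : bijective f.
Proof. by apply: inj_card_bij f_inj _; rewrite card_prod card_bool card_ord. Qed.

Lemma sum_characteristics (V : nmodType) (g : bool * bool -> V) :
  \sum_(i < 4) g (f i) = g (true, true) + g (true, false) + (g (false, true) + g (false, false)).
Proof.
have <- : \sum_u g u = \sum_(i < 4) g (f i) by rewrite (reindex f) //; exact: onW_bij f_bij.
rewrite (eq_bigr (fun u => g (u.1, u.2))); last by case.
by rewrite -(pair_bigA _ (fun a b => g (a, b))) /= !big_bool.
Qed.

Lemma sum_bsgn (R : realType) j : \sum_(i < 4) bsgn (c i j) = 0 :> R.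
Proof.
rewrite (eq_bigr (fun i => bsgn (coord3 (f i) j))); last by move=> i _; rewrite c_coord3.
rewrite (sum_characteristics _ (fun u => bsgn (coord3 u j))).
by move: j; apply: ord3_ind; rewrite /bsgn /coord3 /= expr0 expr1; ring.
Qed.

(** The signs for j = 0, 1, 2 are the three nontrivial characters of F_2^2, and this is their
    orthogonality. *)
Lemma sum_bsgnM (R : realType) j j' :
  \sum_(i < 4) bsgn (c i j) * bsgn (c i j') = 4 * (j == j')%:R :> R.
Proof.
rewrite (eq_bigr (fun i => bsgn (coord3 (f i) j) * bsgn (coord3 (f i) j')));
  last by move=> i _; rewrite !c_coord3.
rewrite (sum_characteristics _ (fun u => bsgn (coord3 u j) * bsgn (coord3 u j'))).
by move: j; apply: ord3_ind; move: j'; apply: ord3_ind;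
  rewrite /bsgn /coord3 /= expr0 expr1; ring.
Qed.

Lemma characteristics_sum0 j : c o0 j (+) c o1 j (+) c o2 j (+) c o3 j = false.
Proof.
have n01 : f o0 != f o1 by rewrite (inj_eq f_inj) o_neq.
have n02 : f o0 != f o2 by rewrite (inj_eq f_inj) o_neq.
have n03 : f o0 != f o3 by rewrite (inj_eq f_inj) o_neq.
have n12 : f o1 != f o2 by rewrite (inj_eq f_inj) o_neq.
have n13 : f o1 != f o3 by rewrite (inj_eq f_inj) o_neq.
have n23 : f o2 != f o3 by rewrite (inj_eq f_inj) o_neq.
rewrite !c_coord3; move: n01 n02 n03 n12 n13 n23.
move: (f o0) (f o1) (f o2) (f o3) => [a0 b0] [a1 b1] [a2 b2] [a3 b3].
by move: j; apply: ord3_ind; rewrite /coord3 /=;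
  case: a0; case: b0; case: a1; case: b1; case: a2; case: b2; case: a3; case: b3.
Qed.

(* Since the four characteristics are all of F_2^2, they sum to zero; hence
   c_0 + c_i = c_j + c_k, and (0 i)(j k) acts as translation by this vector. *)
Lemma klein_act_translation s : s \in klein ->
  exists2 w, even3 w & forall i j, c ((s^-1)%g i) j = w j (+) c i j.
Proof.
move=> Hs; exists (fun j => c (s^-1 o0)%g j (+) c o0 j).
  have := c_even o0; have := c_even (s^-1 o0)%g; rewrite /even3.
  by do 3 (case: (c o0 _)); do 3 (case: (c _ _)).
move=> i j; have := characteristics_sum0 j; move: Hs.
rewrite !inE -!orbA; case/or4P=> /eqP ->; rewrite ?invg1 ?invMg ?tpermV ?perm1;
  move: i; apply: ord4_ind;
  rewrite ?permM ?perm1 ?permE /= ?(eqxx, o_neq) /= ?permE /= ?(eqxx, o_neq) /=;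
  by case: (c o0 j); case: (c o1 j); case: (c o2 j); case: (c o3 j).
Qed.

(** By transitivity some Klein element agrees with the translation by [w] at [o0]. It acts as a
    translation itself, and translations agreeing at one point coincide. *)
Lemma klein_translation_act w : even3 w ->
  exists2 s, s \in klein & forall i j, c ((s^-1)%g i) j = w j (+) c i j.
Proof.
move=> Hw; have [g _ gf] := f_bij.
have [i0 [H1 H2]] : exists i0, f i0 =
    (w ord0 (+) c o0 ord0, w (lift ord0 ord0) (+) c o0 (lift ord0 ord0)).
  by eexists; exact: gf.
have Hi0 j : c i0 j = w j (+) c o0 j.
  by move: j; apply: ord3_ind => //; rewrite !even3E // H1 H2 addbACA.
have [s Hs Hs0] := klein_transitive i0.
exists s => // i j; have [w' _ Hw'] := klein_act_translation s Hs.
rewrite Hw'; congr (_ (+) _).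
by have := Hw' o0 j; rewrite Hs0 Hi0 => /addIb.
Qed.
End Characteristics.

(** * Image, vertices and edges of the parallelepiped *)

Section Parallelepiped.
Context {R : realType}.
Variables (p : 'I_3 -> R) (c : 'I_4 -> 'I_3 -> bool).
Hypothesis p_gt0 : forall j, 0 < p j.
Hypothesis c_even : forall i, even3 (c i).
Hypothesis c_inj : forall i i', (forall j, c i j = c i' j) -> i = i'.

(** Row j is the change of [zigzag_point] as D_j passes from -p_j to p_j. *)
Definition edges : 'M[R]_3 :=
  \matrix_(j, i) (p j * (bsgn (c (lift ord0 i) j) - bsgn (c ord0 j))).

Definition zigzag_point (D : 'I_3 -> R) : 'rV[R]_3 :=
  \row_i \sum_j (bsgn (c (lift ord0 i) j) - bsgn (c ord0 j)) * (D j / 2).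

Lemma edges_unit : edges \in unitmx.
Proof.
have /mulmx1_unit[//] : edges *m (\matrix_(i, j) (bsgn (c (lift ord0 i) j) / (4 * p j))) = 1%:M.
apply/matrixP=> j j'; rewrite !mxE.
(* The added term for [ord0] vanishes; it completes the sum to all four characteristics, so that
   orthogonality of characters applies. *)
have -> : \sum_i edges j i * (\matrix_(i, j) (bsgn (c (lift ord0 i) j) / (4 * p j))) i j' =
  p j / (4 * p j') * \sum_(i < 4) (bsgn (c i j) * bsgn (c i j') - bsgn (c ord0 j) * bsgn (c i j')).
  rewrite [in RHS]big_ord_recl subrr add0r mulr_sumr; apply: eq_bigr => i _.
  by rewrite !mxE; ring.
rewrite sumrB -mulr_sumr sum_bsgn // sum_bsgnM // mulr0 subr0.
case: eqP => [<-|_]; last by rewrite !mulr0.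
by have pj := p_gt0 j; rewrite /= mulr1n; field; rewrite gt_eqF.
Qed.

Lemma edges_point (t : 'rV[R]_3) :
  zigzag_point (fun j => - p j) + t *m edges =
  zigzag_point (fun j => - p j + 2 * p j * t 0 j).
Proof.
apply/rowP=> i; rewrite !mxE -big_split /=; apply: eq_bigr => j _.
by rewrite !mxE; field.
Qed.

Lemma torus_coord_zigzag (A : R) (D : 'I_3 -> R) :
  torus_coord (fun i => A + \sum_j bsgn (c i j) * D j / 2) = zigzag_point D.
Proof.
apply/rowP=> i; rewrite !mxE opprD addrACA subrr add0r -sumrB.
by apply: eq_bigr => j _; ring.
Qed.

Definition Theta (y : 'I_3 -> R) (i : 'I_4) : R := inf (theta_values p y (c i)).

Lemma Theta_cell y k : in_cell p y k -> on_wall p y k -> exists A,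
  Theta y = (fun i => A + \sum_j bsgn (c i j) * zigzag (p j) (y j) (k j) / 2).
Proof.
move=> Hc Hw.
exists (\sum_j (parabola (p j) (y j) (k j) + parabola (p j) (y j) (k j + 1)) / 2).
apply/funext => i; rewrite /Theta (inf_theta_values _ _ _ _ p_gt0 Hc Hw) //.
by rewrite -big_split /=; apply: eq_bigr => j _; exact: parabola_nearest.
Qed.

Lemma Theta_shift y d : Theta (fun j => y j + d) = Theta y.
Proof. by apply/funext => i; rewrite /Theta theta_values_shift. Qed.

Lemma Theta0 : exists A,
  Theta (fun=> 0) = (fun i => A + \sum_j bsgn (c i j) * (- p j) / 2).
Proof.
(* The point 0 lies in the cells of both -1 and 0, and the zigzag value there is -p_j for either; a
   single -1 yields the required sum. *)
pose k (j : 'I_3) : int := if j == ord0 then -1 else 0.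
have Hc : in_cell p (fun=> 0) k.
  move=> j; have pj := p_gt0 j; rewrite /k; case: eqP => _.
    by apply/andP; split; rewrite ?addNr ?rmorphN /=; lra.
  by apply/andP; split; rewrite ?add0r /=; lra.
have [|A HA] := Theta_cell _ _ Hc.
  split; first by rewrite sum3.
  by exists (lift ord0 ord0); rewrite mulr0.
exists A; rewrite HA; apply/funext => i; congr (_ + _); apply: eq_bigr => j _.
congr (_ * _ / _); rewrite /zigzag /bsgn /k; case: eqP => _ /=; rewrite ?expr0 ?expr1; ring.
Qed.

Lemma image_Theta : [set torus_coord (Theta y) | y in [set: 'I_3 -> R]] =
  ppd_boundary (zigzag_point (fun j => - p j)) edges.
Proof.
apply/seteqP; split=> z.
- move=> [y _ <-]; have [d [k [Hc Hw]]] := wall_shift p p_gt0 y.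
  rewrite -(Theta_shift y d); have [A ->] := Theta_cell _ _ Hc Hw.
  rewrite torus_coord_zigzag.
  pose D j := zigzag (p j) (y j + d) (k j).
  have HD j : - p j <= D j <= p j by apply: zigzag_bound; exact: Hc.
  (* This solves D_j = -p_j + 2 p_j t_j for t. *)
  exists (\row_j ((D j + p j) / (2 * p j))); split.
  + move=> j; rewrite mxE; have /andP[H1 H2] := HD j; have pj := p_gt0 j.
    by rewrite divr_ge0 ?ler_pdivrMr /=; lra.
  + have [_ [i Hi]] := Hw; exists i; rewrite mxE.
    have := zigzag_wall (p i) (k i); rewrite -Hi -/(D i) => -[->|->].
      by left; rewrite addNr mul0r.
    right; have pi := p_gt0 i; field; by rewrite gt_eqF.
  + rewrite edges_point; congr zigzag_point; apply/funext => j; rewrite mxE -/(D j).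
    by have pj := p_gt0 j; move: (D j) => Dj; field; rewrite gt_eqF.
- move=> [t [Ht [i Hi] ->]]; rewrite edges_point.
  pose D j := - p j + 2 * p j * t 0 j.
  have HD j : - p j <= D j <= p j.
    by have /andP[H1 H2] := Ht j; have := p_gt0 j; rewrite /D => pj; apply/andP; split; nra.
  (* At the lower end of its cell the zigzag is -p for even k and p for odd k, so the parity of [ki]
     selects the face. A second index [i'] then absorbs the remainder of the sum -1. *)
  pose ki : int := if t 0 i == 0 then 0 else 1.
  have [i' Hi'] : exists i' : 'I_3, i' != i.
    by move: (i); apply: ord3_ind; [exists (lift ord0 ord0) | exists ord0 | exists ord0].
  pose k (j : 'I_3) : int := if j == i then ki else if j == i' then -1 - ki else 0.
  have Hk : \sum_j k j = -1.
    rewrite (bigD1 i) //= (bigD1 i') //= big1 ?addr0 /k ?eqxx ?(negPf Hi').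
      by rewrite addrC subrK.
    by move=> j /andP[/negPf -> /negPf ->].
  have Hy j : exists y, [/\ 2 * p j * (k j)%:~R <= y <= 2 * p j * (k j + 1)%:~R,
      zigzag (p j) y (k j) = D j & j = i -> y = 2 * p j * (k j)%:~R].
    have [->|/eqP Hj] := eqVneq j i; last first.
      by have [y [H1 H2]] := zigzag_surj (p j) (D j) (k j) (HD j); exists y; split.
    exists (2 * p i * (k i)%:~R); have pi := p_gt0 i; split=> //.
      by rewrite lexx /= rmorphD /=; lra.
    rewrite /D /k eqxx /ki /zigzag /bsgn.
    case: Hi => ->; rewrite ?eqxx ?oner_eq0 /= ?expr0 ?expr1; ring.
  have [y {}Hy] := choice Hy.
  exists y => //.
  have [A ->] : exists A, Theta y =
      (fun i => A + \sum_j bsgn (c i j) * zigzag (p j) (y j) (k j) / 2).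
    apply: Theta_cell; first by move=> j; have [] := Hy j.
    by split=> //; exists i; have [_ _ ->] := Hy i.
  rewrite torus_coord_zigzag; congr zigzag_point.
  by apply/funext => j; have [_ -> _] := Hy j.
Qed.

Lemma perm_act_zigzag (A : R) (D : 'I_3 -> R) (s : {perm 'I_4}) (w : 'I_3 -> bool) :
  (forall i j, c ((s^-1)%g i) j = w j (+) c i j) ->
  perm_act s (fun i => A + \sum_j bsgn (c i j) * D j / 2) =
  (fun i => A + \sum_j bsgn (c i j) * (bsgn (w j) * D j) / 2).
Proof.
move=> Hw; apply/funext => i; rewrite /perm_act; congr (_ + _); apply: eq_bigr => j _.
by rewrite Hw {1}/bsgn signr_addb; rewrite /bsgn; ring.
Qed.

Lemma iota_act_zigzag (A : R) (D : 'I_3 -> R) :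
  iota_act (fun i => A + \sum_j bsgn (c i j) * D j / 2) =
  (fun i => - A + \sum_j bsgn (c i j) * (- D j) / 2).
Proof.
apply/funext => i; rewrite /iota_act opprD -sumrN; congr (_ + _).
by apply: eq_bigr => j _; ring.
Qed.

Lemma orbit_Theta0 : ppd_vertices (zigzag_point (fun j => - p j)) edges =
  klein_iota_orbit (Theta (fun=> 0)).
Proof.
have [A HA] := Theta0.
have orbit_point (s : {perm 'I_4}) (w : 'I_3 -> bool) (e : bool) :
    (forall i j, c ((s^-1)%g i) j = w j (+) c i j) ->
    torus_coord ((if e then @iota_act R else id) (perm_act s (Theta (fun=> 0)))) =
    zigzag_point (fun j => - p j + 2 * p j * (\row_j (if w j (+) e then 1 else 0)) 0 j).
  move=> Hw; rewrite HA (perm_act_zigzag _ _ _ _ Hw).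
  case: e; rewrite ?iota_act_zigzag torus_coord_zigzag; congr zigzag_point;
    apply/funext => j; rewrite mxE /bsgn; case: (w j); rewrite /= ?expr0 ?expr1; ring.
apply/seteqP; split=> z.
- move=> [e ->]; rewrite edges_point.
  (* With three coordinates, an odd pattern of sign changes is the complement of an even one; [pi]
     decides whether iota is needed to complement. *)
  pose pi := e ord0 (+) (e (lift ord0 ord0) (+) e (lift ord0 (lift ord0 ord0))).
  have [|s Hs Hsw] := klein_translation_act c c_even c_inj (fun j => e j (+) pi).
    by rewrite /even3 /pi; do 3 (case: (e _)).
  exists s, pi; split=> //; rewrite (orbit_point s _ pi Hsw); congr zigzag_point.
  by apply/funext => j; rewrite !mxE -addbA addbb addbF.
- move=> [s [e [Hs ->]]]; have [w _ Hw] := klein_act_translation c c_even c_inj s Hs.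
  by rewrite (orbit_point s w e Hw) -edges_point; exists (fun j => w j (+) e).
Qed.
End Parallelepiped.

(** * From polarizations to Selling parameters *)

Section NormalForm.
Context {R : realType}.
Implicit Types (L Q : 'M[R]_2) (E : 'M[int]_2).

Definition rmx {m n} (A : 'M[int]_(m, n)) : 'M[R]_(m, n) := map_mx (fun z : int => z%:~R) A.

Lemma rmxM m n k (A : 'M[int]_(m, n)) (B : 'M[int]_(n, k)) :
  rmx (A *m B) = rmx A *m rmx B.
Proof. exact: (map_mxM intr). Qed.

Lemma rmx_unit E : E \in unitmx -> rmx E \in unitmx.
Proof.
move=> Eu; have /mulmx1_unit[//] : rmx E *m rmx (invmx E) = 1%:M.
by rewrite -rmxM mulmxV // /rmx map_mx1.
Qed.

Lemma sum2 (V : nmodType) (F : 'I_2 -> V) : \sum_j F j = F 0 + F 1.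
Proof.
by rewrite !big_ord_recl big_ord0 addr0; congr (_ + F _); apply: val_inj.
Qed.

Lemma ord2_ind (P : 'I_2 -> Prop) : P 0 -> P 1 -> forall j, P j.
Proof.
move=> H0 H1 [[|[|//]] h].
- by rewrite (_ : Ordinal h = 0) //; apply: val_inj.
- by rewrite (_ : Ordinal h = 1) //; apply: val_inj.
Qed.

Lemma polarization_unit L Q : principal_polarization L Q -> Q \in unitmx.
Proof.
move=> [_ Qpos _ _ _]; rewrite unitmxE unitfE; apply/det0P => -[v v0 vQ].
by have := Qpos v v0; rewrite /Defs.form vQ mul0mx mxE ltxx.
Qed.

(** Integrality of Q on M' x N gives one direction, surjectivity of lambda onto M the other. *)
Lemma polarization_latticeP L Q u : principal_polarization L Q ->
  in_lattice L u <-> exists m : 'rV[int]_2, u = rmx m *m invmx Q.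
Proof.
move=> HQ; have Qu := polarization_unit _ _ HQ; have [_ _ Qint _ Qsurj] := HQ.
split=> [Lu|[m ->]]; last first.
  have [u' Lu' Hu'] := Qsurj m.
  by rewrite (_ : _ *m _ = u') // -[u'](mulmxK Qu); congr (_ *m _); rewrite -[LHS]Hu'.
exists (\row_j Num.floor ((u *m Q) 0 j)); apply: (canRL (mulmxK Qu)).
apply/rowP => j; rewrite [RHS]mxE mxE floorK //.
have := Qint u (delta_mx 0 j) Lu.
rewrite /Defs.form.
have -> : ivec R (delta_mx 0 j) = delta_mx 0 j by exact: (map_delta_mx intr).
by rewrite trmx_delta -colE mxE.
Qed.

Lemma polarization_inv_pos L Q (v : 'rV[R]_2) : principal_polarization L Q -> v != 0 ->
  0 < (v *m invmx Q *m v^T) 0 0.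
Proof.
move=> HQ v0; have Qu := polarization_unit _ _ HQ; have [Qsym Qpos _ _ _] := HQ.
have : v *m invmx Q != 0.
  by apply: contra_neq v0 => H; rewrite -[v](mulmxKV Qu) H mul0mx.
by move/Qpos; rewrite /Defs.form mulmxKV // trmx_mul trmx_inv Qsym mulmxA.
Qed.

(** The Gram matrix of the rows of [E], as vectors of M, for the form dual to [Q]. *)
Definition gram Q E : 'M[R]_2 := rmx E *m invmx Q *m (rmx E)^T.

Lemma gram_sym L Q E : principal_polarization L Q -> gram Q E 1 0 = gram Q E 0 1.
Proof.
move=> [Qsym _ _ _ _].
have H : gram Q E = (gram Q E)^T.
  by rewrite /gram !trmx_mul trmxK trmx_inv Qsym mulmxA.
by rewrite [in LHS]H mxE.
Qed.

Lemma gram_diag_gt0 L Q E i : principal_polarization L Q -> E \in unitmx ->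
  0 < gram Q E i i.
Proof.
move=> HQ Eu.
have d0 : row i (rmx E) != 0.
  rewrite rowE; apply/eqP => H; have /rowP/(_ i) : delta_mx 0 i = 0 :> 'rV[R]_2.
    by rewrite -[LHS](mulmxK (rmx_unit _ Eu)) H mul0mx.
  by rewrite !mxE !eqxx => /eqP; rewrite oner_eq0.
have := polarization_inv_pos _ _ _ HQ d0.
have key (X Y : 'M[R]_2) : (row i X *m col i Y) 0 0 = (X *m Y) i i.
  by rewrite !mxE; apply: eq_bigr => k _; rewrite !mxE.
by rewrite -row_mul tr_row key.
Qed.

(* With H = E Q^-1 E^T diagonal, Q = E^T H^-1 E, so A = E^T splits the form and
   carries M' = Z^2 Q^-1 onto Z^2 H. *)
Lemma diagonal_gram_product L Q E : principal_polarization L Q ->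
  E \in unitmx -> gram Q E 0 1 = 0 -> is_product L Q.
Proof.
move=> HQ Eu H01; have Qu := polarization_unit _ _ HQ.
have H10 : gram Q E 1 0 = 0 by rewrite (gram_sym _ _ _ HQ).
have h0 := gram_diag_gt0 _ _ _ 0 HQ Eu; have h1 := gram_diag_gt0 _ _ _ 1 HQ Eu.
exists E^T, (gram Q E 0 0), (gram Q E 1 1), (gram Q E 0 0)^-1, (gram Q E 1 1)^-1.
have trE : map_mx (fun z : int => z%:~R) E^T = (rmx E)^T :> 'M[R]_2 by rewrite map_trmx.
have diag_row (a : 'rV[int]_2) : rmx a *m gram Q E =
    \row_(i < 2) (if i == 0 then gram Q E 0 0 * (a 0 0)%:~R else gram Q E 1 1 * (a 0 1)%:~R).
  move: (gram Q E) H01 H10 => H H01 H10.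
  apply/rowP; apply: ord2_ind; rewrite !mxE sum2 !mxE ?H01 ?H10 ?mulr0 ?addr0 ?add0r;
    exact: mulrC.
have mulEG (a : 'rV[int]_2) :
    rmx (a *m E) *m invmx Q *m (rmx E)^T = rmx a *m gram Q E.
  by rewrite rmxM /gram !mulmxA.
split.
- by rewrite unitmx_tr.
- by rewrite !invr_gt0 !gt_eqF.
- move=> y; rewrite trE; split.
  + move=> [x /(polarization_latticeP _ _ _ HQ)[m ->] ->].
    pose a := m *m invmx E; exists (a 0 0), (a 0 1).
    have -> : m = a *m E by rewrite /a mulmxKV.
    by rewrite mulEG diag_row.
  + move=> [k1 [k2 ->]].
    pose a : 'rV[int]_2 := \row_j (if j == 0 then k1 else k2).
    exists (rmx (a *m E) *m invmx Q).
      by apply/(polarization_latticeP _ _ _ HQ); exists (a *m E).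
    rewrite mulEG diag_row; apply/rowP; apply: ord2_ind; by rewrite !mxE.
- move=> x y; rewrite trE /=.
  pose D : 'M[R]_2 := diag_mx (\row_(i < 2) (gram Q E i i)^-1).
  have HD : gram Q E *m D = 1%:M.
    rewrite /D; move: (gram Q E) H01 H10 h0 h1 => H H01 H10 h0 h1.
    apply/matrixP; apply: ord2_ind; apply: ord2_ind;
      rewrite mul_mx_diag !mxE ?H01 ?H10 ?mul0r ?mulfV ?(gt_eqF h0) ?(gt_eqF h1) //.
  have HQD : Q = (rmx E)^T *m D *m rmx E.
    have /mulmx1C : rmx E *m (invmx Q *m (rmx E)^T *m D) = 1%:M.
      by rewrite -HD /gram !mulmxA.
    by move/(congr1 (mulmx Q)); rewrite mulmx1 !mulmxA mulmxV // mul1mx.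
  rewrite /Defs.form {1}HQD.
  have -> : x *m ((rmx E)^T *m D *m rmx E) *m y^T =
      (x *m (rmx E)^T) *m D *m (y *m (rmx E)^T)^T.
    by rewrite trmx_mul trmxK !mulmxA.
  rewrite mxE sum2 mul_mx_diag.
  move: (x *m _) (y *m _) => x' y'; rewrite !mxE; ring.
Qed.

Definition mx2 (a b c d : int) : 'M[int]_2 :=
  \matrix_(i, j) if i == 0 then (if j == 0 then a else b) else (if j == 0 then c else d).

Lemma mx2_unit (a b c d : int) : a * d - b * c = 1 -> mx2 a b c d \in unitmx.
Proof.
move=> Hdet; have /mulmx1_unit[//] : mx2 a b c d *m mx2 d (- b) (- c) a = 1%:M.
by apply/matrixP; apply: ord2_ind; apply: ord2_ind; rewrite !mxE sum2 !mxE /=; lia.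
Qed.

Lemma gram_mx2 L Q a b c d : principal_polarization L Q ->
  let B := bform R (invmx Q 0 0) (invmx Q 0 1) (invmx Q 1 1) in
  [/\ gram Q (mx2 a b c d) 0 0 = B a b a b, gram Q (mx2 a b c d) 0 1 = B a b c d &
      gram Q (mx2 a b c d) 1 1 = B c d c d].
Proof.
move=> [Qsym _ _ _ _] B.
have G10 : invmx Q 1 0 = invmx Q 0 1 by rewrite -[in LHS]Qsym -trmx_inv mxE.
rewrite /gram /B /bform; move: (invmx Q) G10 => G G10.
by split; rewrite !mxE !sum2 !mxE !sum2 !mxE /= G10; ring.
Qed.

(** An equality in the obtuse inequalities would make one of the bases (u, v), (u, u+v), (u+v, v)
    orthogonal and so split the surface as a product. *)
Lemma irreducible_obtuse_basis L Q : principal_polarization L Q -> irreducible L Q ->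
  exists E : 'M[int]_2, [/\ E \in unitmx, gram Q E 0 1 < 0,
    0 < gram Q E 0 0 + gram Q E 0 1 & 0 < gram Q E 1 1 + gram Q E 0 1].
Proof.
move=> HQ Hirr; set g := invmx Q 0 0; set h := invmx Q 0 1; set l := invmx Q 1 1.
have G10 : invmx Q 1 0 = h by have [Qsym _ _ _ _] := HQ; rewrite -[in LHS]Qsym -trmx_inv mxE.
have Gpos (v : 'rV[R]_2) : v != 0 ->
    0 < g * v 0 0 ^+ 2 + 2 * h * (v 0 0 * v 0 1) + l * v 0 1 ^+ 2.
  move=> v0; have := polarization_inv_pos _ _ _ HQ v0.
  rewrite !mxE !sum2 !mxE !sum2 G10 -/g -/h -/l => H.
  by apply: etrans H; congr (_ < _); ring.
have g0 : 0 < g.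
  have := Gpos (\row_j (if j == 0 then 1 else 0)); rewrite !mxE /= expr0n /=.
  rewrite expr1n mulr1 !mulr0 !addr0; apply.
  by apply/eqP => /rowP/(_ 0); rewrite !mxE /= => /eqP; rewrite oner_eq0.
have det0 : 0 < g * l - h ^+ 2.
  rewrite -(pmulr_rgt0 _ g0).
  (* The form takes the value g (g l - h^2) at (-h, g). *)
  have := Gpos (\row_j (if j == 0 then - h else g)); rewrite !mxE /= => H.
  have -> : g * (g * l - h ^+ 2) = g * (- h) ^+ 2 + 2 * h * (- h * g) + l * g ^+ 2 by ring.
  apply: H; apply/eqP => /rowP/(_ 1); rewrite !mxE /= => /eqP.
  by rewrite gt_eqF.
have [a [b [c [d [Hdet H1 H2 H3]]]]] := obtuse_basis _ _ _ _ g0 det0.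
have Hne a' b' c' d' : a' * d' - b' * c' = 1 -> bform _ g h l a' b' c' d' != 0.
  move=> Hdet'; apply/eqP => H0; apply: Hirr.
  apply: (diagonal_gram_product _ _ (mx2 a' b' c' d') HQ (mx2_unit _ _ _ _ Hdet')).
  by have [_ -> _] := gram_mx2 _ _ a' b' c' d' HQ.
have [E00 E01 E11] := gram_mx2 _ _ a b c d HQ.
exists (mx2 a b c d); rewrite mx2_unit // E00 E01 E11 -/g -/h -/l.
split=> //; rewrite lt_def.
- by rewrite H1 andbT eq_sym; exact: Hne.
- rewrite H2 andbT; have := Hne a b (c + a) (d + b) ltac:(lia).
  by apply: contra_neq => <-; rewrite /bform !rmorphD /=; ring.
- rewrite H3 andbT; have := Hne (a + c) (b + d) c d ltac:(lia).
  by apply: contra_neq => <-; rewrite /bform !rmorphD /=; ring.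
Qed.

Definition triple {T : Type} (a b c : T) (j : 'I_3) : T := nth c [:: a; b] j.

(* Selling's formula a H a^T = (H_00 + H_01) a_0^2 + (H_11 + H_01) a_1^2
   - H_01 (a_0 - a_1)^2, with H the Gram matrix, explains the next three
   definitions. *)
Definition lattice_coords (a : 'rV[int]_2) : 'I_3 -> int :=
  triple (- a 0 0) (a 0 1) (a 0 0 - a 0 1).

Definition selling Q E : 'I_3 -> R :=
  triple ((gram Q E 0 0 + gram Q E 0 1) / 4) ((gram Q E 1 1 + gram Q E 0 1) / 4)
    (- gram Q E 0 1 / 4).

Definition dual_coords E (x : 'rV[R]_2) : 'I_3 -> R :=
  triple ((x *m (rmx E)^T) 0 0) (- (x *m (rmx E)^T) 0 1) 0.

(** With v = a E, the matrix [Q] cancels against its inverse and leaves x.v + v Q^-1 v^T / 4, to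
    which Selling's formula applies. *)
Lemma theta_term L Q E x (a : 'rV[int]_2) : principal_polarization L Q ->
  let w := 2^-1 *: (rmx (a *m E) *m invmx Q) in
  2 * Defs.form Q x w + Defs.form Q w w =
  \sum_j parabola (selling Q E j) (dual_coords E x j) (lattice_coords a j).
Proof.
move=> HQ w; have Qu := polarization_unit _ _ HQ; have [Qsym _ _ _ _] := HQ.
have wT : w^T = 2^-1 *: (invmx Q *m (rmx E)^T *m (rmx a)^T).
  by rewrite /w linearZ /= rmxM !trmx_mul trmx_inv Qsym mulmxA.
have -> : Defs.form Q x w = 2^-1 * (x *m (rmx E)^T *m (rmx a)^T) 0 0.
  by rewrite /Defs.form wT -scalemxAr !mulmxA mulmxK // mxE.
have -> : Defs.form Q w w = 4^-1 * (rmx a *m gram Q E *m (rmx a)^T) 0 0.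
  rewrite /Defs.form wT -scalemxAr mxE /w -!scalemxAl mxE mulrA; congr (_ * _ ); first by field.
  by rewrite rmxM /gram !mulmxA mulmxKV.
have := gram_sym _ _ E HQ.
rewrite /parabola /selling /dual_coords /lattice_coords sum3 /triple /=.
move: (gram Q E) (x *m _) => H y H10.
by rewrite !mxE !sum2 !mxE !sum2 !mxE H10 rmorphN rmorphB /=; field.
Qed.

Lemma even_lattice_coords (a : 'rV[int]_2) : even3 (fun j => zodd (lattice_coords a j)).
Proof. by rewrite /even3 /lattice_coords /triple /= /zodd; apply/eqP; lia. Qed.

Lemma zodd_lattice_coords (a a' : 'rV[int]_2) :
  (forall j, zodd (lattice_coords a j) = zodd (lattice_coords a' j)) ->
  exists d, a = 2 *: d + a'.
Proof.
move=> H; exists (\row_j divz (a 0 j - a' 0 j) 2).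
apply/rowP; apply: ord2_ind; rewrite !mxE.
- by have := H ord0; rewrite /lattice_coords /triple /= /zodd; lia.
- by have := H (lift ord0 ord0); rewrite /lattice_coords /triple /= /zodd; lia.
Qed.

Lemma rmx_double (d a : 'rV[int]_2) : rmx (2 *: d + a) = 2 *: rmx d + rmx a :> 'rV[R]_2.
Proof. by apply/rowP => j; rewrite !mxE rmorphD rmorphM. Qed.

Lemma theta_sellingE L Q E (b : 'rV[int]_2) x : principal_polarization L Q -> E \in unitmx ->
  theta L Q b x = inf (theta_values (selling Q E) (dual_coords E x)
    (fun j => zodd (lattice_coords (b *m invmx E) j))).
Proof.
move=> HQ Eu; congr inf.
have Hc (m : 'rV[int]_2) : rmx m *m invmx Q + half_char Q b =
    2^-1 *: (rmx (((2 *: m + b) *m invmx E) *m E) *m invmx Q).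
  rewrite mulmxKV // rmx_double /half_char mulmxDl scalerDr -scalemxAl scalerA.
  by rewrite mulVf ?scale1r // pnatr_eq0.
apply/seteqP; split=> t.
- move=> [u /(polarization_latticeP _ _ _ HQ)[m ->] ->].
  rewrite Hc (theta_term _ _ _ _ _ HQ).
  exists (lattice_coords ((2 *: m + b) *m invmx E)) => //; split.
    by rewrite sum3 /lattice_coords /triple /=; lia.
  rewrite mulmxDl -scalemxAl; move: (m *m _) (b *m _) => m' b'.
  by apply: ord3_ind; rewrite /lattice_coords /triple /= /zodd !mxE;
    move: (m' 0 0) (m' 0 1) (b' 0 0) (b' 0 1) => m0 m1 b0 b1; lia.
- move=> [n [Hn Hp] ->].
  (* This inverts [lattice_coords]; the third coordinate is recovered from the zero sum. *)
  pose a : 'rV[int]_2 := \row_j (if j == 0 then - n ord0 else n (lift ord0 ord0)).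
  have Ha : n = lattice_coords a.
    move: Hn; rewrite sum3 => Hn.
    by apply/funext; apply: ord3_ind; rewrite /lattice_coords /triple /= !mxE /=; lia.
  have [d Hd] := zodd_lattice_coords a (b *m invmx E) ltac:(by move=> j; rewrite -Ha Hp).
  exists (rmx (d *m E) *m invmx Q).
    by apply/(polarization_latticeP _ _ _ HQ); exists (d *m E).
  rewrite Hc (theta_term _ _ _ _ _ HQ) Ha; congr (\sum_j parabola _ _ (lattice_coords _ _)).
  by rewrite mulmxDl -scalemxAl mulmxK // -Hd.
Qed.
End NormalForm.

Theorem theorem4p7 (R : realType) (L Q : 'M[R]_2) (b : 'I_4 -> 'rV[int]_2) :
  L \in unitmx ->
  principal_polarization L Q ->
  irreducible L Q ->
  reps L Q b ->
  exists (p : 'rV[R]_3) (V : 'M[R]_3),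
    [/\ V \in unitmx,
        ppd_vertices p V = klein_iota_orbit (psi_hom L Q b 0) &
        [set torus_coord (psi_hom L Q b x) | x in [set: 'rV[R]_2]]
          = ppd_boundary p V].
Proof.
move=> _ HQ Hirr Hb.
have [E [Eu H01 H0 H1]] := irreducible_obtuse_basis _ _ HQ Hirr.
pose p := selling Q E; pose c i j := zodd (lattice_coords (b i *m invmx E) j).
have p_gt0 j : 0 < p j.
  by move: j; apply: ord3_ind; rewrite /p /selling /triple /=; lra.
have c_even i : even3 (c i) by exact: even_lattice_coords.
have c_inj i i' : (forall j, c i j = c i' j) -> i = i'.
  move=> /zodd_lattice_coords[d Hd].
  (* Equal parities make [b i] and [b i'] congruent modulo 2 M, so both indices represent the class
     of [b i], and uniqueness identifies them. *)
  have [k [_ Hk]] := Hb (b i).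
  apply: etrans (esym (Hk i _)) (Hk i' _).
    exists 0; first by exists 0; rewrite /ivec map_mx0 mul0mx.
    by rewrite subrr /lam mul0mx scaler0.
  exists (rmx (d *m E) *m invmx Q).
    by apply/(polarization_latticeP _ _ _ HQ); exists (d *m E).
  have -> : b i = 2 *: (d *m E) + b i'.
    by rewrite -[LHS](mulmxKV Eu) Hd mulmxDl mulmxKV // scalemxAl.
  by rewrite /lam mulmxKV ?(polarization_unit _ _ HQ) // [ivec R _]rmx_double addrK.
have psiE x : psi_hom L Q b x = Theta p c (dual_coords E x).
  by apply/funext => i; rewrite /psi_hom /Theta (theta_sellingE _ _ _ _ _ HQ Eu).
exists (zigzag_point c (fun j => - p j)), (edges p c); split.
- exact: edges_unit.
- rewrite psiE (orbit_Theta0 _ _ p_gt0 c_even c_inj); congr (klein_iota_orbit (Theta _ _ _)).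
  by apply/funext; apply: ord3_ind; rewrite /dual_coords /triple /= ?mul0mx ?mxE ?oppr0.
- rewrite -(image_Theta _ _ p_gt0 c_even); apply/seteqP; split=> _ [x _ <-].
    by exists (dual_coords E x) => //; rewrite psiE.
  have Eu' := rmx_unit _ Eu.
  (* Subtracting the third coordinate moves the triple [x] along (1,1,1) to one whose last entry is
     0, as for every value of [dual_coords]; the sign of the second entry follows that
     definition. *)
  pose x' : 'rV[R]_2 := \row_j (if j == 0 then x ord0 - x (lift ord0 (lift ord0 ord0))
    else x (lift ord0 (lift ord0 ord0)) - x (lift ord0 ord0)).
  exists (x' *m invmx (rmx E)^T) => //; rewrite psiE; congr torus_coord.
  rewrite -(Theta_shift _ _ _ (x (lift ord0 (lift ord0 ord0)))); congr Theta.
  apply/funext; apply: ord3_ind;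
    by rewrite /dual_coords /triple /= ?mulmxKV ?unitmx_tr ?Eu' ?mxE //=; ring.
Qed.
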